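(* The actual motions of a mechanical system with regular and ideal non-holonomic constraints represented by a submanifold $C\subset TQ$, given by independent equations $C^a(q,\dot q)=0$, $a=1,\dots,r$, are the integral curves based on $C$ of the vector field $$\mathbf D=\mathbf X_G+\mathbf A+\mathbf R,$$ where the components $R^i$ of the vertical vector $\mathbf R=R^i\,\partial/\partial\dot q^i$ are $$R^i(q,\dot q)=G_{ab}\,C^{ai}\left(C^b_j(\Gamma^j_{hk}\dot q^h\dot q^k-A^j)-\dot q^j\,\partial_jC^b\right).$$ With the symbols $$\pi^{ij}=G_{ab}\,C^{ai}C^{bj},\qquad C^{ai}=g^{ij}C^a_j,\qquad C^i_a=G_{ab}\,C^{bi},$$ the explicit expressions of the first-order differential system associated with $\mathbf D$ and of the reactive forces are $$\frac{dq^i}{dt}=\dot q^i,\qquad \frac{d\dot q^i}{dt}=(g^{ij}-\pi^{ij})\left(A_j-\Gamma_{hkj}\dot q^h\dot q^k\right)-\dot q^j\,\partial_jC^a\,C^i_a,$$ and $$R^i=\pi^{ij}\left(\Gamma_{hkj}\dot q^h\dot q^k-A_j\right)-\dot q^j\,\partial_jC^a\,C^i_a,$$ respectively.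
   Context: Repeated indices are summed; $h,i,j,k\in\{1,\dots,n\}$, $a,b\in\{1,\dots,r\}$. All data are smooth. $Q$ is the $n$-dimensional configuration manifold of a mechanical system with local coordinates $q=(q^i)$; $TQ$ has coordinates $(q,\dot q)$. The kinetic energy is $K=\tfrac12g_{ij}(q)\dot q^i\dot q^j$ with $[g_{ij}]$ positive definite, $[g^{ij}]=[g_{ij}]^{-1}$, $\partial_i=\partial/\partial q^i$, $\Gamma_{hkj}=\tfrac12(\partial_hg_{kj}+\partial_kg_{jh}-\partial_jg_{hk})$, $\Gamma^i_{hk}=g^{ij}\Gamma_{hkj}$. The Lagrangian active forces $A_i=A_i(q,\dot q)$ are given, and $A^i=g^{ij}A_j$. The constraint $C\subset TQ$ is regular: it is a submanifold of dimension $n+m$, $m<n$, each $C\cap T_qQ$ is a submanifold of dimension $m$, and the restriction to $C$ of the tangent fibration $TQ\to Q$ is a surjective submersion. With $r=n-m$, it is represented by independent equations $C^a(q,\dot q)=0$, and $C^a_i=\partial C^a/\partial\dot q^i$ has rank $r$. Set $G^{ab}=g^{ij}C^a_iC^b_j$ and $[G_{ab}]=[G^{ab}]^{-1}$. The motions of the system obey the Lagrange equations $\frac{d}{dt}\frac{\partial K}{\partial\dot q^i}-\frac{\partial K}{\partial q^i}=A_i+R_i$, where $R_i$ are the Lagrangian reactive forces and $R^i=g^{ij}R_j$. Actual motions are those which moreover satisfy $(q(t),\dot q(t))\in C$ for all $t$. The constraints are ideal: this means that $R_i=\lambda_a C^a_i$ for some (a priori unknown) multipliers $\lambda_a$. $\mathbf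 X_G=\dot q^i\,\partial/\partial q^i-\Gamma^i_{hk}\dot q^h\dot q^k\,\partial/\partial\dot q^i$ is the geodesic flow vector field on $TQ$ and $\mathbf A=A^i\,\partial/\partial\dot q^i$. Integral curves ''based on $C$'' are those starting from a point of $C$. *)

(* Defs.v *)
From HB Require Import structures.
From mathcomp Require Import all_boot all_order all_algebra.
From mathcomp Require Import all_classical all_reals all_analysis.
Set Implicit Arguments.
Unset Strict Implicit.
Unset Printing Implicit Defensive.
Import Order.TTheory GRing.Theory Num.Theory.
Import numFieldNormedType.Exports.
Local Open Scope classical_set_scope.
Local Open Scope ring_scope.

(* C^k on the open set O.  On the finite-dimensional spaces E used below, taking
   all the directional derivatives is the same as taking the partial ones. *)
Fixpoint class_C (R : realType) (E F : normedModType R) (k : nat) (O : set E)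
    (f : E -> F) : Prop :=
  match k with
  | 0%N => forall x, O x -> {for x, continuous f}
  | k'.+1 => (forall x, O x -> differentiable f x) /\
             (forall e : E, class_C k' O (fun x => 'D_e f x))
  end.

Definition smooth_on (R : realType) (E F : normedModType R) (O : set E)
    (f : E -> F) : Prop := forall k, class_C k O f.

Definition basis_vec (R : realType) (n : nat) (i : 'I_n) : 'rV[R]_n :=
  delta_mx 0 i.

(* Embedded d-dimensional submanifolds of an N-dimensional normed space E:
   locally the zero set of a smooth submersion onto R^(N - d). *)
Definition is_submanifold (R : realType) (E : normedModType R) (N d : nat)
    (S : set E) : Prop :=
  (d <= N)%N /\
  forall p, S p -> exists (O : set E) (F : E -> 'rV[R]_(N - d)),
    [/\ open O, O p, smooth_on O F,
        (forall x, O x -> (S x <-> F x = 0)) &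
        (forall x, O x -> forall w, exists e, 'd F x e = w)].

(* Velocities at p of the curves lying in S. *)
Definition tangent_space (R : realType) (E : normedModType R) (S : set E)
    (p : E) : set E :=
  [set w | exists c : R -> E,
     [/\ c 0 = p, \forall s \near (0 : R), S (c s) & is_derive (0 : R) 1 c w]].

(** ** Manifolds and tangent bundles *)

Record manifold (R : realType) (n : nat) := Manifold {
  carrier :> topologicalType;
  chart : Type;
  dom : chart -> set carrier;
  crd : chart -> carrier -> 'rV[R]_n;
  pt : chart -> 'rV[R]_n -> carrier; (* inverse of [crd] *)
  point_hausdorff : hausdorff_space carrier;
  point_second_countable : @second_countable carrier;
  dom_open : forall a, open (dom a);
  dom_cover : forall q, exists a, dom a q;
  crdK : forall a q, dom a q -> pt a (crd a q) = q;
  rng_open : forall a, open (crd a @` dom a);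
  crd_continuous : forall a q, dom a q -> {for q, continuous (crd a)};
  pt_continuous :
    forall a x, (crd a @` dom a) x -> {for x, continuous (pt a)};
  trans_smooth : forall a b,
    smooth_on (crd a @` (dom a `&` dom b)) (crd b \o pt a)
}.

Definition rng (R : realType) (n : nat) (Q : manifold R n) (a : chart Q) :
  set 'rV[R]_n := crd a @` dom a.

(* A tangent vector at [base u] is the family of its components in all the
   charts around [base u]; [vel u a] is set to 0 for the other charts, so that
   tangent vectors with the same base point and components are equal. *)
Record tvec (R : realType) (n : nat) (Q : manifold R n) := TVec {
  base : Q;
  vel : chart Q -> 'rV[R]_n;
  vel_out : forall a, ~ dom a base -> vel a = 0;
  vel_trans : forall a b, dom a base -> dom b base ->
    vel b = 'd (crd b \o pt a) (crd a base) (vel a)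
}.

(* The natural coordinates (q, qdot) on TQ. *)
Definition tcrd (R : realType) (n : nat) (Q : manifold R n) (a : chart Q)
    (u : tvec Q) : 'rV[R]_n * 'rV[R]_n := (crd a (base u), vel u a).

Section TangentPoint.
Variables (R : realType) (n : nat) (Q : manifold R n) (a : chart Q).
Variable p : 'rV[R]_n * 'rV[R]_n.

Definition tpt_vel (b : chart Q) : 'rV[R]_n :=
  if `[< rng a p.1 /\ dom b (pt a p.1) >] then 'd (crd b \o pt a) (p.1) p.2
  else 0.

Lemma rng_dom x : rng a x -> dom a (pt a x).
Proof. by case=> q qa <-; rewrite crdK. Qed.

Lemma ptK x : rng a x -> crd a (pt a x) = x.
Proof. by case=> q qa <-; rewrite crdK. Qed.

Lemma trans_differentiable b x : rng a x -> dom b (pt a x) ->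
  differentiable (crd b \o pt a) x.
Proof.
move=> ax bx; have [+ _] := @trans_smooth _ _ Q a b 1%N; apply.
by exists (pt a x); [split => //; exact: rng_dom | exact: ptK].
Qed.

Lemma tpt_out b : ~ dom b (pt a p.1) -> tpt_vel b = 0.
Proof. by move=> bp; rewrite /tpt_vel; case: asboolP => // -[]. Qed.

End TangentPoint.

Lemma diff_chain (R : realType) (U V W : normedModType R) (f : U -> V)
    (g : V -> W) (h : U -> W) (x v : U) :
  differentiable f x -> differentiable g (f x) -> differentiable h x ->
  (\forall y \near x, h y = g (f y)) ->
  'd h x v = 'd g (f x) ('d f x v).
Proof.
move=> df dg dh e; rewrite -(deriveE v dh).
rewrite (near_eq_derive (g := g \o f) v e) deriveE; last exact: differentiable_comp.
by rewrite diff_comp.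
Qed.

Lemma tpt_trans (R : realType) (n : nat) (Q : manifold R n) (a : chart Q)
    (p : 'rV[R]_n * 'rV[R]_n) (b c : chart Q) :
  dom b (pt a p.1) -> dom c (pt a p.1) ->
  tpt_vel a p c = 'd (crd c \o pt b) (crd b (pt a p.1)) (tpt_vel a p b).
Proof.
move=> bp cp; rewrite /tpt_vel.
case: asboolP => [[ap _]|nap]; last first.
  by case: asboolP => [[ap _]|_]; [case: nap | rewrite linear0].
case: asboolP => [_|[]//].
have dab := trans_differentiable ap bp.
have bq : rng b (crd b (pt a p.1)) by exists (pt a p.1).
have dbc : differentiable (crd c \o pt b) (crd b (pt a p.1)).
  by apply: trans_differentiable => //; rewrite crdK.
have dac := trans_differentiable ap cp.
apply: (@diff_chain R _ _ _ (crd b \o pt a) (crd c \o pt b) (crd c \o pt a)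
  p.1 p.2 dab dbc dac).
have : nbhs p.1 (pt a @^-1` dom b).
  by apply: (pt_continuous ap); apply: open_nbhs_nbhs; split=> //; exact: dom_open.
by apply: filterS => x bx /=; rewrite crdK.
Qed.

(* The tangent vector with coordinates p = (x, v) in the chart a
   (meaningful for x in [rng a]). *)
Definition tpt (R : realType) (n : nat) (Q : manifold R n) (a : chart Q)
    (p : 'rV[R]_n * 'rV[R]_n) : tvec Q :=
  TVec (@tpt_out R n Q a p) (@tpt_trans R n Q a p).

(* Coordinate expression of a subset of TQ. *)
Definition loc_set (R : realType) (n : nat) (Q : manifold R n) (a : chart Q)
    (S : set (tvec Q)) : set ('rV[R]_n * 'rV[R]_n) :=
  [set p | rng a p.1 /\ S (tpt a p)].

(* Coordinate expression of a function on TQ. *)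
Definition loc_fun (R : realType) (n : nat) (Q : manifold R n) (a : chart Q)
    (f : tvec Q -> R) : 'rV[R]_n * 'rV[R]_n -> R := fun p => f (tpt a p).

(* The partial derivatives with respect to q^i and qdot^i. *)
Definition dq (R : realType) (n : nat) (i : 'I_n)
    (f : 'rV[R]_n * 'rV[R]_n -> R) (p : 'rV[R]_n * 'rV[R]_n) : R :=
  'D_((basis_vec R i, 0) : 'rV[R]_n * 'rV[R]_n) f p.

Definition dv (R : realType) (n : nat) (i : 'I_n)
    (f : 'rV[R]_n * 'rV[R]_n -> R) (p : 'rV[R]_n * 'rV[R]_n) : R :=
  'D_((0, basis_vec R i) : 'rV[R]_n * 'rV[R]_n) f p.

(** ** Kinetic energy, forces, constraints

    The kinetic energy is given by the inner products [ip u w] of the pairs of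
    tangent vectors u, w with the same base point, and the active forces by
    their values [A u w] on these pairs (the force in the state u is a linear
    form on the tangent space at [base u]); the values of [ip] and [A] on other
    pairs are irrelevant. *)

Section Mechanics.
Variables (R : realType) (n : nat) (Q : manifold R n).
Variables (ip A : tvec Q -> tvec Q -> R).
Variables (r : nat) (Ceq : 'I_r -> tvec Q -> R).

Section Components.
Variable a : chart Q.

Definition gmetric (x : 'rV[R]_n) : 'M[R]_n :=
  \matrix_(i, j) ip (tpt a (x, basis_vec R i)) (tpt a (x, basis_vec R j)).

Definition inv_gmetric (x : 'rV[R]_n) : 'M[R]_n := invmx (gmetric x).

Definition active_force (i : 'I_n) (p : 'rV[R]_n * 'rV[R]_n) : R :=
  A (tpt a p) (tpt a (p.1, basis_vec R i)).

Definition kinetic (p : 'rV[R]_n * 'rV[R]_n) : R :=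
  2^-1 * \sum_i \sum_j gmetric p.1 i j * p.2 0 i * p.2 0 j.

Definition dmetric (h i j : 'I_n) (x : 'rV[R]_n) : R :=
  'D_(basis_vec R h) (fun y => gmetric y i j) x.

(* Gamma_{hkj} and Gamma^i_{hk} *)
Definition christoffel1 (h k j : 'I_n) (x : 'rV[R]_n) : R :=
  2^-1 * (dmetric h k j x + dmetric k j h x - dmetric j h k x).

Definition christoffel2 (i h k : 'I_n) (x : 'rV[R]_n) : R :=
  \sum_j inv_gmetric x i j * christoffel1 h k j x.

Section AtPoint.
Variable p : 'rV[R]_n * 'rV[R]_n.
Let x := p.1.
Let v := p.2.

(* A^i *)
Definition active_up (i : 'I_n) : R :=
  \sum_j inv_gmetric x i j * active_force j p.

(* C^b_i and d_j C^b *)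
Definition Cv (b : 'I_r) (i : 'I_n) : R := dv i (loc_fun a (Ceq b)) p.
Definition Cq (b : 'I_r) (j : 'I_n) : R := dq j (loc_fun a (Ceq b)) p.

Definition Cmx : 'M[R]_(r, n) := \matrix_(b, i) Cv b i.

(* G^{bc}, with inverse G_{bc} *)
Definition Gup : 'M[R]_r :=
  \matrix_(b, c) \sum_i \sum_j inv_gmetric x i j * Cv b i * Cv c j.
Definition Glow : 'M[R]_r := invmx Gup.

(* C^{bi}, C^i_b, pi^{ij} *)
Definition Cup (b : 'I_r) (i : 'I_n) : R := \sum_j inv_gmetric x i j * Cv b j.
Definition Cmix (i : 'I_n) (b : 'I_r) : R := \sum_c Glow b c * Cup c i.
Definition pi_tensor (i j : 'I_n) : R :=
  \sum_b \sum_c Glow b c * Cup b i * Cup c j.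

(* R^i *)
Definition reactive_up (i : 'I_n) : R :=
  \sum_b \sum_c Glow b c * Cup b i *
    (\sum_j Cv c j *
       (\sum_h \sum_k christoffel2 j h k x * v 0 h * v 0 k - active_up j)
     - \sum_j v 0 j * Cq c j).

(* The vector fields X_G, A, R and D on TQ, by their components along d/dq and
   d/dqdot in the natural coordinates of the chart a. *)
Definition geodesic_field : 'rV[R]_n * 'rV[R]_n :=
  (v, \row_i - (\sum_h \sum_k christoffel2 i h k x * v 0 h * v 0 k)).
Definition active_field : 'rV[R]_n * 'rV[R]_n := (0, \row_i active_up i).
Definition reactive_field : 'rV[R]_n * 'rV[R]_n := (0, \row_i reactive_up i).
Definition D_field : 'rV[R]_n * 'rV[R]_n :=
  geodesic_field + active_field + reactive_field.

(* Gamma_{hkj} qdot^h qdot^k *)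
Definition christoffel_vv (j : 'I_n) : R :=
  \sum_h \sum_k christoffel1 h k j x * v 0 h * v 0 k.

(* qdot^j (d_j C^b) C^i_b *)
Definition drift (i : 'I_n) : R :=
  \sum_j \sum_b v 0 j * Cq b j * Cmix i b.

End AtPoint.
End Components.

Definition kinetic_metric : Prop := forall a : chart Q,
  [/\ (forall i j, smooth_on (rng a) (fun x => gmetric a x i j)),
      (forall x (v w : 'rV[R]_n), rng a x -> ip (tpt a (x, v)) (tpt a (x, w)) =
          \sum_i \sum_j gmetric a x i j * v 0 i * w 0 j),
      (forall x i j, rng a x -> gmetric a x i j = gmetric a x j i) &
      (forall x (v : 'rV[R]_n), rng a x -> v != 0 ->
          0 < \sum_i \sum_j gmetric a x i j * v 0 i * v 0 j)].

Definition force_law : Prop := forall a : chart Q,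
  (forall i, smooth_on [set p | rng a p.1] (active_force a i)) /\
  (forall x (v w : 'rV[R]_n), rng a x -> A (tpt a (x, v)) (tpt a (x, w)) =
      \sum_i active_force a i (x, v) * w 0 i).

Definition open_in_TQ (W : set (tvec Q)) : Prop :=
  forall a : chart Q, open (loc_set a W).

Definition regular_constraint (m : nat) (C : set (tvec Q)) : Prop :=
  [/\ (forall a : chart Q, is_submanifold (n + n) (n + m) (loc_set a C)),
      (forall (a : chart Q) (x : 'rV[R]_n), rng a x ->
          is_submanifold n m [set v | C (tpt a (x, v))]),
      (forall q : Q, exists2 u, C u & base u = q) &
      (forall (a : chart Q) p, loc_set a C p -> forall e : 'rV[R]_n,
          exists w, tangent_space (loc_set a C) p (e, w))].

(* The equations need only be defined on an open set W of TQ. *)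
Definition independent_equations (W C : set (tvec Q)) : Prop :=
  [/\ open_in_TQ W,
      (forall (a : chart Q) b, smooth_on (loc_set a W) (loc_fun a (Ceq b))),
      (forall u, C u <-> W u /\ forall b, Ceq b u = 0) &
      (forall (a : chart Q) p, loc_set a C p -> \rank (Cmx a p) = r)].

(* The domain of D: off the points where the equations are independent,
   [G^{bc}] is singular. *)
Definition D_domain (W : set (tvec Q)) : set (tvec Q) :=
  [set u | W u /\
     forall a : chart Q, dom a (base u) -> \rank (Cmx a (tcrd a u)) = r].

(** ** Motions and integral curves on an open interval J *)

(* c = (q, dq/dt) *)
Definition tangent_lift (J : set R) (q : R -> Q) (c : R -> tvec Q) : Prop :=
  forall t, J t ->
    [/\ {for t, continuous q}, base (c t) = q t &
        forall a : chart Q, dom a (q t) ->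
          is_derive t 1 (fun s => crd a (q s)) (vel (c t) a)].

(* [RF t a] is the row of the components R_i, in the chart a, of the reactive
   force at time t; [c] is the lift (q, dq/dt) of the motion. *)
Definition lagrange_equations (J : set R) (c : R -> tvec Q)
    (RF : R -> chart Q -> 'rV[R]_n) : Prop :=
  forall t (a : chart Q), J t -> dom a (base (c t)) ->
    derivable (fun s => vel (c s) a) t 1 /\
    forall i,
      derive1 (fun s => dv i (kinetic a) (tcrd a (c s))) t
        - dq i (kinetic a) (tcrd a (c t))
      = active_force a i (tcrd a (c t)) + RF t a 0 i.

Definition ideal_reaction (J : set R) (c : R -> tvec Q)
    (RF : R -> chart Q -> 'rV[R]_n) : Prop :=
  forall t (a : chart Q), J t -> dom a (base (c t)) ->
    exists lam : 'I_r -> R,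
      forall i, RF t a 0 i = \sum_b lam b * Cv a (tcrd a (c t)) b i.

Definition actual_motion (C : set (tvec Q)) (J : set R) (q : R -> Q)
    (c : R -> tvec Q) (RF : R -> chart Q -> 'rV[R]_n) : Prop :=
  [/\ tangent_lift J q c, lagrange_equations J c RF, ideal_reaction J c RF &
      forall t, J t -> C (c t)].

Definition integral_curve_D (W : set (tvec Q)) (J : set R)
    (c : R -> tvec Q) : Prop :=
  forall t, J t ->
    [/\ D_domain W (c t), {for t, continuous (fun s => base (c s))} &
        forall a : chart Q, dom a (base (c t)) ->
          is_derive t 1 (fun s => tcrd a (c s)) (D_field a (tcrd a (c t)))].

End Mechanics.

(* Main.v *)
Require Import Defs.
From HB Require Import structures.
From mathcomp Require Import all_boot all_order all_algebra.
From mathcomp Require Import all_classical all_reals all_analysis.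
Import Order.TTheory GRing.Theory Num.Theory.
Import numFieldNormedType.Exports.
Local Open Scope classical_set_scope.
Local Open Scope ring_scope.

(** Everything takes place in one chart, where the components are arranged as row
    vectors. Write g for the metric, M for the r x n matrix of the C^a_i, F and
    Gamma for the rows of A_j and Gamma_{hkj} qdot^h qdot^k, w for the row of
    qdot^j d_j C^b and acc for the derivative of the velocity.

    The Euler-Lagrange expression of the kinetic energy is acc g + Gamma
    ([euler_lagrange_kinetic]), so a motion with reaction l M has
    acc = (F - Gamma + l M) g^-1 ([newton_covariantP]). On the other hand the
    b-th equation changes at the rate (w + acc M^T)_b ([is_derive_equation]). The
    Gram matrix M g^-1 M^T, which is G^{ab}, is invertible because g is positive
    definite and M has full rank ([gram_unitmx]); hence the condition
    w + acc M^T = 0 holds for exactly one row of multipliers,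
    l = - (w + (F - Gamma) g^-1 M^T) G^-1 ([multiplierP]), and the vector
    l M g^-1 is R ([reactive_upE]).

    Both inclusions follow. Along an actual motion the equations vanish
    identically, so their rate of change is zero, which forces this value of l and
    the curve satisfies the equations of D ([actual_motion_reaction]).
    Conversely, D is built with this l, so the equations are first integrals of
    D; vanishing at one instant they vanish on the whole interval
    ([integral_curve_constraint]), and reading Newton's law backwards gives
    Lagrange's equations with the reaction l M ([integral_curve_motion]). The
    explicit expressions of D and R result from expanding l, the matrix of pi
    being g^-1 M^T G^-1 M g^-1. *)

(** * Linear algebra of the multipliers *)

Definition posdef_mx {R : realFieldType} {n : nat} (g : 'M[R]_n) : Prop :=
  forall v : 'rV[R]_n, v != 0 -> 0 < (v *m g *m v^T) 0 0.

Lemma posdef_unitmx {R : realFieldType} {n : nat} (g : 'M[R]_n) :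
  posdef_mx g -> g \in unitmx.
Proof.
move=> gpos; rewrite -row_free_unit; apply: inj_row_free => v vg.
apply: contraTeq (isT) => /gpos.
by rewrite vg mul0mx mxE ltxx.
Qed.

(** The Gram matrix of independent covectors is again positive definite: its
    quadratic form at u is the squared length of the vector dual to the
    covector u M. *)
Lemma gram_unitmx {R : realFieldType} {r n : nat} (g : 'M[R]_n)
    (M : 'M[R]_(r, n)) :
  g^T = g -> posdef_mx g -> row_free M -> M *m invmx g *m M^T \in unitmx.
Proof.
move=> gsym gpos Mfree; have gU := posdef_unitmx g gpos.
apply: posdef_unitmx => u u0.
have y0 : u *m M *m invmx g != 0.
  rewrite mulmx_free_eq0 ?mulmx_free_eq0 //.
  by rewrite row_free_unit unitmx_inv.
have := gpos _ y0.
by rewrite !trmx_mul trmx_inv gsym !mulmxA mulmxKV.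
Qed.

(** The condition fixing the multipliers: with f the row of the forces and w
    the velocity part of the derivative of the equations, the acceleration
    (f + l M) / g is compatible with the equations for exactly one l. *)
Lemma multiplierP {R : realFieldType} {r n : nat} (gi : 'M[R]_n)
    (M : 'M[R]_(r, n)) (f : 'rV[R]_n) (w l : 'rV[R]_r) :
  M *m gi *m M^T \in unitmx ->
  w + (f + l *m M) *m gi *m M^T = 0 <->
  l = - (w + f *m gi *m M^T) *m invmx (M *m gi *m M^T).
Proof.
move=> GU; have -> : w + (f + l *m M) *m gi *m M^T =
    (w + f *m gi *m M^T) + l *m (M *m gi *m M^T).
  by rewrite !mulmxDl !mulmxA addrA.
split=> [e|->]; last by rewrite mulmxKV // subrr.
by apply: (can_inj (mulmxK GU)); rewrite mulmxKV //; apply/esym/eqP;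
  rewrite -subr_eq0 -opprD oppr_eq0 e.
Qed.

(** * Components as row vectors and matrices *)

Section Rows.
Context {R : realType} {n : nat} {Q : manifold R n}.
Variables (ip A : tvec Q -> tvec Q -> R).
Context {r : nat}.
Variables (Ceq : 'I_r -> tvec Q -> R) (a : chart Q).
Variable p : 'rV[R]_n * 'rV[R]_n.

Definition geodesic_row : 'rV[R]_n := \row_j christoffel_vv ip a p j.
Definition force_row : 'rV[R]_n := \row_j active_force A a j p.
Definition drift_row : 'rV[R]_r := \row_b \sum_j p.2 0 j * Cq Ceq a p b j.
(** The multipliers singled out by [multiplierP], with f the row of the
    non-reactive forces: active force minus inertial terms. *)
Definition multiplier_row : 'rV[R]_r :=
  - (drift_row + (force_row - geodesic_row) *m inv_gmetric ip a p.1
       *m (Cmx Ceq a p)^T) *m Glow ip Ceq a p.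

Lemma GupE :
  Gup ip Ceq a p = Cmx Ceq a p *m inv_gmetric ip a p.1 *m (Cmx Ceq a p)^T.
Proof.
apply/matrixP => b c; rewrite !mxE.
rewrite exchange_big /=; apply: eq_bigr => j _; rewrite !mxE big_distrl /=.
by apply: eq_bigr => i _; rewrite !mxE; congr (_ * _); exact: mulrC.
Qed.

End Rows.

Section SymmetricMetric.
Context {R : realType} {n : nat} {Q : manifold R n}.
Variables (ip A : tvec Q -> tvec Q -> R).
Context {r : nat}.
Variables (Ceq : 'I_r -> tvec Q -> R) (a : chart Q).
Variable p : 'rV[R]_n * 'rV[R]_n.
Hypothesis gsym : (gmetric ip a p.1)^T = gmetric ip a p.1.

Lemma inv_gmetric_tr : (inv_gmetric ip a p.1)^T = inv_gmetric ip a p.1.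
Proof. by rewrite /inv_gmetric trmx_inv gsym. Qed.

Lemma inv_gmetric_sym i j :
  inv_gmetric ip a p.1 i j = inv_gmetric ip a p.1 j i.
Proof. by rewrite -[in LHS]inv_gmetric_tr mxE. Qed.

Lemma Glow_sym b c : Glow ip Ceq a p b c = Glow ip Ceq a p c b.
Proof.
suff : (Glow ip Ceq a p)^T = Glow ip Ceq a p.
  by move/matrixP/(_ c b); rewrite mxE.
by rewrite /Glow trmx_inv GupE !trmx_mul trmxK inv_gmetric_tr mulmxA.
Qed.

Lemma CupE b i : Cup ip Ceq a p b i = (Cmx Ceq a p *m inv_gmetric ip a p.1) b i.
Proof.
rewrite mxE; apply: eq_bigr => j _.
by rewrite !mxE inv_gmetric_sym mulrC.
Qed.

Lemma active_upE i : active_up ip A a p i =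
  (force_row A a p *m inv_gmetric ip a p.1) 0 i.
Proof.
rewrite mxE; apply: eq_bigr => j _.
by rewrite !mxE inv_gmetric_sym mulrC.
Qed.

Lemma geodesic_upE i :
  \sum_h \sum_k christoffel2 ip a i h k p.1 * p.2 0 h * p.2 0 k =
  (geodesic_row ip a p *m inv_gmetric ip a p.1) 0 i.
Proof.
rewrite mxE.
under eq_bigr => h _ do
  (under eq_bigr => k _ do rewrite /christoffel2 2!big_distrl /=;
   rewrite exchange_big /=).
rewrite exchange_big /=; apply: eq_bigr => j _.
rewrite !mxE /christoffel_vv big_distrl /=; apply: eq_bigr => h _.
rewrite big_distrl /=; apply: eq_bigr => k _.
by rewrite inv_gmetric_sym [RHS]mulrC !mulrA.
Qed.

(** The force with covariant components given by these multipliers has R^i as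
    contravariant components. *)
Lemma reactive_upE i : reactive_up ip A Ceq a p i =
  (multiplier_row ip A Ceq a p *m Cmx Ceq a p *m inv_gmetric ip a p.1) 0 i.
Proof.
rewrite -mulmxA mxE; apply: eq_bigr => b _.
rewrite -CupE mxE big_distrl /=; apply: eq_bigr => c _.
rewrite Glow_sym -[RHS]mulrA [RHS]mulrC; congr (_ * _).
have -> (X Y : 'rV[R]_r) : (- (X + Y)) 0 c = - Y 0 c - X 0 c.
  by rewrite !mxE opprD addrC.
congr (_ - _); last by rewrite mxE.
rewrite mxE -sumrN; apply: eq_bigr => j _.
rewrite geodesic_upE active_upE mulmxBl [_^T _ _]mxE [Cmx _ _ _ _ _]mxE.
have -> (X Y : 'rV[R]_n) : (X - Y) 0 j = X 0 j - Y 0 j by rewrite !mxE.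
by rewrite -mulNr opprB mulrC.
Qed.

Lemma pi_tensorE i j : pi_tensor ip Ceq a p i j =
  ((Cmx Ceq a p *m inv_gmetric ip a p.1)^T *m Glow ip Ceq a p
    *m (Cmx Ceq a p *m inv_gmetric ip a p.1)) i j.
Proof.
rewrite mxE /pi_tensor exchange_big /=; apply: eq_bigr => c _.
rewrite mxE big_distrl /=; apply: eq_bigr => b _.
by rewrite -CupE // mxE -CupE // [Cup _ _ _ _ b i * _]mulrC.
Qed.

Lemma driftE i : drift ip Ceq a p i =
  (drift_row Ceq a p *m Glow ip Ceq a p
    *m (Cmx Ceq a p *m inv_gmetric ip a p.1)) 0 i.
Proof.
rewrite -mulmxA mxE /drift exchange_big /=; apply: eq_bigr => b _.
rewrite mxE -big_distrl; congr (_ * _).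
by rewrite mxE; apply: eq_bigr => c _; rewrite -CupE.
Qed.

Lemma reactive_up_pi i : reactive_up ip A Ceq a p i =
  \sum_j pi_tensor ip Ceq a p i j *
    (christoffel_vv ip a p j - active_force A a j p) - drift ip Ceq a p i.
Proof.
rewrite reactive_upE // driftE //.
(* Contracting R with pi amounts to multiplying the row of force components by
   the matrix of pi, on the right because pi is symmetric. *)
have -> : \sum_j pi_tensor ip Ceq a p i j *
    (christoffel_vv ip a p j - active_force A a j p) =
  ((geodesic_row ip a p - force_row A a p) *m inv_gmetric ip a p.1 *m
    (Cmx Ceq a p)^T *m Glow ip Ceq a p *m Cmx Ceq a p
    *m inv_gmetric ip a p.1) 0 i.
  have piS j : pi_tensor ip Ceq a p i j = pi_tensor ip Ceq a p j i.
    rewrite /pi_tensor exchange_big /=.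
    apply: eq_bigr => b _; apply: eq_bigr => c _.
    by rewrite Glow_sym // -!mulrA [Cup _ _ _ _ _ _ * _]mulrC.
  under eq_bigr => j _ do rewrite piS pi_tensorE trmx_mul inv_gmetric_tr //.
  rewrite -!mulmxA mxE; apply: eq_bigr => j _; rewrite mulrC; congr (_ * _).
  by rewrite !mxE.
have -> (X Y : 'rV[R]_n) : X 0 i - Y 0 i = (X - Y) 0 i by rewrite !mxE.
rewrite /multiplier_row !mulmxA -!mulmxBl; congr ((_ *m _ *m _ *m _) 0 i).
by rewrite opprD addrC -!mulNmx opprB.
Qed.

(** In this form the velocity component of D is a solution of Newton's law as
    written in [newton_covariantP]. *)
Lemma D_fieldE : D_field ip A Ceq a p =
  (p.2, (force_row A a p - geodesic_row ip a p
         + multiplier_row ip A Ceq a p *m Cmx Ceq a p)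
        *m inv_gmetric ip a p.1).
Proof.
rewrite /D_field /geodesic_field /active_field /reactive_field.
congr pair; rewrite /= ?addr0 //.
apply/rowP => i.
have DE (X Y : 'rV[R]_n) : (X + Y) 0 i = X 0 i + Y 0 i by rewrite !mxE.
rewrite !mulmxDl !DE mulNmx [(- (geodesic_row _ _ _ *m _)) 0 i]mxE.
rewrite [in LHS]mxE [in X in _ + X + _]mxE [in X in _ + X = _]mxE.
by rewrite geodesic_upE // active_upE // reactive_upE // [X in X + _]addrC.
Qed.

Lemma D_field_pi : D_field ip A Ceq a p =
  (p.2, \row_i (\sum_j (inv_gmetric ip a p.1 i j - pi_tensor ip Ceq a p i j) *
      (active_force A a j p - christoffel_vv ip a p j) - drift ip Ceq a p i)).
Proof.
rewrite /D_field /geodesic_field /active_field /reactive_field.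
congr pair; rewrite /= ?addr0 //.
apply/rowP => i; rewrite !mxE geodesic_upE // active_upE // reactive_up_pi.
rewrite addrA; congr (_ - _).
have -> (X Y : 'rV[R]_n) : - X 0 i + Y 0 i = (Y - X) 0 i by rewrite !mxE addrC.
rewrite -mulmxBl mxE -big_split; apply: eq_bigr => j _ /=.
rewrite !mxE inv_gmetric_sym // [RHS]mulrBl -mulrN opprB.
by rewrite [X in X + _]mulrC.
Qed.
End SymmetricMetric.

(** * Derivatives along curves and partial derivatives *)

Lemma is_derive_comp_diff {R : realType} {U V X : normedModType R}
    (g : U -> V) (f : V -> X) (s e : U) :
  differentiable g s -> differentiable f (g s) ->
  is_derive s e (fun t => f (g t)) ('d f (g s) ('d g s e)).
Proof.
move=> dg df.
have dfg : differentiable (f \o g) s by exact: differentiable_comp.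
apply: DeriveDef; first exact: diff_derivable.
by rewrite (deriveE e dfg) diff_comp.
Qed.

Lemma is_derive_diff {R : realType} {V : normedModType R} (f : R -> V)
    (t : R) (w : V) :
  is_derive t 1 f w -> differentiable f t /\ 'd f t 1 = w.
Proof.
move=> [df dfE]; have /derivable1_diffP dft := df; split => //.
by rewrite -deriveE.
Qed.

Lemma is_derive_pair {R : realType} {U V : normedModType R} (f : R -> U)
    (g : R -> V) (t : R) (u : U) (v : V) :
  is_derive t 1 f u -> is_derive t 1 g v ->
  is_derive t 1 (fun s => (f s, g s)) (u, v).
Proof.
move=> /is_derive_diff[df dfE] /is_derive_diff[dg dgE].
have dfg := differentiable_pair df dg.
apply: DeriveDef; first exact: diff_derivable.
by rewrite deriveE // diff_pair //= dfE dgE.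
Qed.

Lemma is_diff_fst {R : realType} {U V : normedModType R} (p : U * V) :
  is_diff p fst fst.
Proof.
have h : continuous (fst : U * V -> U) by move=> x; exact: cvg_fst.
by apply: DiffDef; [exact: linear_differentiable | rewrite diff_lin].
Qed.

Lemma is_diff_snd {R : realType} {U V : normedModType R} (p : U * V) :
  is_diff p snd snd.
Proof.
have h : continuous (snd : U * V -> V) by move=> x; exact: cvg_snd.
by apply: DiffDef; [exact: linear_differentiable | rewrite diff_lin].
Qed.

Lemma is_derive_fst {R : realType} {U V : normedModType R} (f : R -> U * V)
    (t : R) (w : U * V) :
  is_derive t 1 f w -> is_derive t 1 (fun s => (f s).1) w.1.
Proof.
move=> /is_derive_diff[df <-].
have [d1 dE] := is_diff_fst (f t).
by have := is_derive_comp_diff f _ t (1 : R) df d1; rewrite dE.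
Qed.

Lemma is_derive_snd {R : realType} {U V : normedModType R} (f : R -> U * V)
    (t : R) (w : U * V) :
  is_derive t 1 f w -> is_derive t 1 (fun s => (f s).2) w.2.
Proof.
move=> /is_derive_diff[df <-].
have [d1 dE] := is_diff_snd (f t).
by have := is_derive_comp_diff f _ t (1 : R) df d1; rewrite dE.
Qed.

Lemma diff_row {R : realType} {n : nat} {V : normedModType R}
    (f : 'rV[R]_n -> V) (x y : 'rV[R]_n) :
  differentiable f x ->
  'd f x y = \sum_i y 0 i *: 'D_(basis_vec R i) f x.
Proof.
move=> df; rewrite [in LHS](row_sum_delta y) linear_sum.
by apply: eq_bigr => i _; rewrite linearZ deriveE.
Qed.

Lemma diff_phase {R : realType} {n : nat} (f : 'rV[R]_n * 'rV[R]_n -> R)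
    (p w : 'rV[R]_n * 'rV[R]_n) :
  differentiable f p ->
  'd f p w = \sum_i w.1 0 i * dq i f p + \sum_i w.2 0 i * dv i f p.
Proof.
move=> df; have {1}-> : w = \sum_i w.1 0 i *: (basis_vec R i, 0)
     + \sum_i w.2 0 i *: (0, basis_vec R i).
  case: w => x y /=.
  have ps (I : Type) (s : seq I) (F : I -> 'rV[R]_n * 'rV[R]_n) :
      \sum_(i <- s) F i = (\sum_(i <- s) (F i).1, \sum_(i <- s) (F i).2).
    elim: s => [|i s IH]; first by rewrite !big_nil.
    by rewrite !big_cons IH.
  rewrite !ps /=; congr pair => /=.
    rewrite [X in _ + X]big1 ?addr0; last by move=> i _; rewrite scaler0.
    exact: row_sum_delta.
  rewrite [X in X + _]big1 ?add0r; last by move=> i _; rewrite scaler0.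
  exact: row_sum_delta.
rewrite linearD !linear_sum; congr (_ + _); apply: eq_bigr => i _.
  by rewrite linearZ /dq deriveE.
by rewrite linearZ /dv deriveE.
Qed.

(** * The Euler-Lagrange expression of the kinetic energy *)

Section Kinetic.
Context {R : realType} {n : nat} {Q : manifold R n}.
Variables (ip : tvec Q -> tvec Q -> R) (a : chart Q).
Hypothesis hip : kinetic_metric ip.
Local Notation phase := ('rV[R]_n * 'rV[R]_n)%type.

Lemma gmetric_tr x : rng a x -> (gmetric ip a x)^T = gmetric ip a x.
Proof.
by move=> ax; have [_ _ gs _] := hip a; apply/matrixP => i j; rewrite mxE gs.
Qed.

Lemma gmetric_posdef x : rng a x -> posdef_mx (gmetric ip a x).
Proof.
move=> ax v v0; have [_ _ _ /(_ _ _ ax v0)] := hip a.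
rewrite mxE; under [X in _ -> is_true (_ < X)]eq_bigr => j _ do
  rewrite !mxE big_distrl /=.
rewrite exchange_big /=; congr (_ < _).
apply: eq_bigr => i _; apply: eq_bigr => j _.
by rewrite [v 0 j * _]mulrC.
Qed.

Lemma gmetric_unitmx x : rng a x -> gmetric ip a x \in unitmx.
Proof. by move=> ax; exact/posdef_unitmx/gmetric_posdef. Qed.

Lemma gmetric_differentiable x i j :
  rng a x -> differentiable (fun y => gmetric ip a y i j) x.
Proof. by move=> ax; have [/(_ i j 1%N)[+ _] _ _ _] := hip a; apply. Qed.

Lemma dmetric_sym x h i j : rng a x ->
  dmetric ip a h i j x = dmetric ip a h j i x.
Proof.
move=> ax; apply: near_eq_derive.
have [_ _ gs _] := hip a.
have : nbhs x (rng a) by apply: open_nbhs_nbhs; split => //; exact: rng_open.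
by apply: filterS => y ay; exact: gs.
Qed.

(** The derivatives along a map c from an arbitrary normed space: with c a curve
    in phase space they give time derivatives, with c the identity the partial
    derivatives of functions on phase space. *)
Section Along.
Context {V : normedModType R}.
Variables (c : V -> phase) (s e : V).
Hypothesis dc : differentiable c s.

Lemma is_derive_velocity i :
  is_derive s e (fun z => (c z).2 0 i) (('d c s e).2 0 i).
Proof.
have [d2 dE] := is_diff_snd (c s).
have dcoord := @differentiable_coord R 1 n (c s).2 0 i.
have := is_derive_comp_diff c _ s e dc (differentiable_comp d2 dcoord).
rewrite diff_comp // dE /=; congr (is_derive _ _ _ _).
have @f : {linear 'rV[R]_n -> R}.
  by exists (fun N : 'rV[R]_n => N 0 i); do 2![eexists]; do ?[constructor];
     rewrite ?mxE// => ? *; rewrite ?mxE//; move=> ?; rewrite !mxE.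
have -> : (fun N : 'rV[R]_n => N 0 i) = f by [].
by rewrite diff_lin //; exact: coord_continuous.
Qed.

Lemma is_derive_gmetric i j : rng a (c s).1 ->
  is_derive s e (fun z => gmetric ip a (c z).1 i j)
    (\sum_h ('d c s e).1 0 h * dmetric ip a h i j (c s).1).
Proof.
move=> ax; have [d1 dE] := is_diff_fst (c s).
have dg := gmetric_differentiable _ i j ax.
have := is_derive_comp_diff c _ s e dc (differentiable_comp d1 dg).
by rewrite diff_comp // dE /= diff_row.
Qed.

Lemma is_derive_momentum i : rng a (c s).1 ->
  is_derive s e (fun z => \sum_j gmetric ip a (c z).1 i j * (c z).2 0 j)
    (\sum_j (gmetric ip a (c s).1 i j * ('d c s e).2 0 j +
       (c s).2 0 j * \sum_h ('d c s e).1 0 h * dmetric ip a h i j (c s).1)).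
Proof.
move=> ax; rewrite -fct_sumE; apply: is_derive_sum => j.
exact: is_deriveM (is_derive_gmetric i j ax) (is_derive_velocity j).
Qed.

Lemma is_derive_kinetic : rng a (c s).1 ->
  is_derive s e (fun z => kinetic ip a (c z))
    (2^-1 * \sum_i \sum_j
       (gmetric ip a (c s).1 i j * (c s).2 0 i * ('d c s e).2 0 j +
        (c s).2 0 j * (gmetric ip a (c s).1 i j * ('d c s e).2 0 i +
          (c s).2 0 i * \sum_h ('d c s e).1 0 h * dmetric ip a h i j (c s).1))).
Proof.
move=> ax; apply: is_deriveZ; rewrite -fct_sumE; apply: is_derive_sum => i.
rewrite -fct_sumE; apply: is_derive_sum => j.
apply: is_deriveM (is_derive_velocity j).
exact: is_deriveM (is_derive_gmetric i j ax) (is_derive_velocity i).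
Qed.
End Along.

Lemma diff_idE (p w : phase) : 'd id p w = w.
Proof. by rewrite diff_val. Qed.

Lemma basis_vecE (i j : 'I_n) : basis_vec R i 0 j = (j == i)%:R.
Proof. by rewrite mxE eqxx. Qed.

Lemma sum_basis_vec (i : 'I_n) (F : 'I_n -> R) :
  \sum_j basis_vec R i 0 j * F j = F i.
Proof.
rewrite (bigD1 i) //= basis_vecE eqxx mul1r big1 ?addr0 // => j ji.
by rewrite basis_vecE (negbTE ji) mul0r.
Qed.

Lemma dq_kinetic p i : rng a p.1 -> dq i (kinetic ip a) p =
  2^-1 * \sum_h \sum_k dmetric ip a i h k p.1 * p.2 0 h * p.2 0 k.
Proof.
move=> ax; have dp : differentiable (id : phase -> phase) p by exact: ex_diff.
have [_ ] := is_derive_kinetic id p (basis_vec R i, 0) dp ax.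
rewrite diff_idE /dq /= => ->; congr (_ * _).
apply: eq_bigr => h _; apply: eq_bigr => k _.
rewrite !mxE !mulr0 !add0r sum_basis_vec.
by rewrite mulrC [_ * dmetric _ _ _ _ _ _]mulrC.
Qed.

(** Both factors of the quadratic form contribute the same sum, as the metric is
    symmetric; this cancels the factor 1/2. *)
Lemma dv_kinetic p i : rng a p.1 -> dv i (kinetic ip a) p =
  \sum_j gmetric ip a p.1 i j * p.2 0 j.
Proof.
move=> ax; have dp : differentiable (id : phase -> phase) p by exact: ex_diff.
have [_ ] := is_derive_kinetic id p (0, basis_vec R i) dp ax.
rewrite diff_idE /dv /= => ->.
have gs k : gmetric ip a p.1 k i = gmetric ip a p.1 i k.
  by rewrite -[in LHS](gmetric_tr _ ax) mxE.
have -> : \sum_h \sum_k (gmetric ip a p.1 h k * p.2 0 h * basis_vec R i 0 k +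
      p.2 0 k * (gmetric ip a p.1 h k * basis_vec R i 0 h +
        p.2 0 h * \sum_l (0 : 'rV[R]_n) 0 l * dmetric ip a l h k p.1)) =
    \sum_h (gmetric ip a p.1 i h * p.2 0 h +
      basis_vec R i 0 h * \sum_k gmetric ip a p.1 h k * p.2 0 k).
  apply: eq_bigr => h _; rewrite -gs big_split /=; congr (_ + _).
    rewrite -(sum_basis_vec i (fun k => gmetric ip a p.1 h k * p.2 0 h)).
    by apply: eq_bigr => k _; rewrite mulrC.
  rewrite big_distrr; apply: eq_bigr => k _ /=.
  rewrite big1 ?mulr0 ?addr0; last by move=> l _; rewrite mxE mul0r.
  by rewrite mulrC -mulrA mulrCA.
by rewrite big_split /= sum_basis_vec mulrDr [2^-1 * _]mulrC -splitr.
Qed.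

(** With S and T the contractions of qdot^h qdot^k with d_h g_{ik} and d_i g_{hk},
    the time derivative of the momentum is acc g + S and the position derivative
    of the kinetic energy is T / 2. Since qdot^h qdot^k is symmetric, the two
    positive terms of the Christoffel symbol both contract to S, so that
    S - T / 2 = (S + S - T) / 2 is the i-th entry of Gamma. *)
Lemma euler_lagrange_kinetic (c : R -> phase) (t : R) (acc : 'rV[R]_n) i :
  rng a (c t).1 -> is_derive t 1 c ((c t).2, acc) ->
  derive1 (fun s => dv i (kinetic ip a) (c s)) t - dq i (kinetic ip a) (c t) =
  (acc *m gmetric ip a (c t).1 + geodesic_row ip a (c t)) 0 i.
Proof.
move=> ax dc; have [dct dcE] := is_derive_diff _ _ _ dc.
have nax : \forall s \near t, rng a (c s).1.
  have cc : {for t, continuous (fun s => (c s).1)}.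
    have [d1 _] := is_diff_fst (c t).
    exact/differentiable_continuous/(differentiable_comp dct d1).
  by apply: cc; apply: open_nbhs_nbhs; split => //; exact: rng_open.
have momE : \forall s \near t,
    \sum_j gmetric ip a (c s).1 i j * (c s).2 0 j = dv i (kinetic ip a) (c s).
  by apply: filterS nax => s axs; rewrite dv_kinetic.
have dmom := near_eq_is_derive momE (is_derive_momentum c t 1 dct i ax).
rewrite derive1E (@derive_val _ _ _ _ _ _ _ dmom) dcE /= dq_kinetic //.
rewrite big_split -addrA [RHS]mxE /=; congr (_ + _).
  rewrite mxE; apply: eq_bigr => j _; rewrite mulrC; congr (_ * _).
  by rewrite -[in LHS](gmetric_tr _ ax) mxE.
set v := (c t).2; set x := (c t).1.
pose S := \sum_h \sum_k dmetric ip a h i k x * v 0 h * v 0 k.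
have -> : \sum_j v 0 j * (\sum_h v 0 h * dmetric ip a h i j x) = S.
  rewrite /S exchange_big; apply: eq_bigr => j _ /=; rewrite big_distrr /=.
  by apply: eq_bigr => h _; rewrite mulrC [v 0 h * _]mulrC.
rewrite mxE /christoffel_vv.
set T := \sum_h \sum_k dmetric ip a i h k x * v 0 h * v 0 k.
have -> : \sum_h \sum_k christoffel1 ip a h k i x * v 0 h * v 0 k =
    2^-1 * (S + S - T).
  have {2}-> : S = \sum_h \sum_k dmetric ip a k i h x * v 0 h * v 0 k.
    rewrite /S exchange_big; apply: eq_bigr => h _; apply: eq_bigr => k _ /=.
    by rewrite mulrAC.
  rewrite /S /T -big_split -sumrB big_distrr; apply: eq_bigr => h _ /=.
  rewrite -big_split -sumrB big_distrr; apply: eq_bigr => k _ /=.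
  by rewrite /christoffel1 (dmetric_sym _ h k i) // -!mulrA -!mulrDl -mulrBl.
by rewrite mulrBr mulrDr [2^-1 * S]mulrC -splitr.
Qed.
End Kinetic.

(** * Curves in the tangent bundle *)

(** The derivative vanishes on J only, so the mean value theorem is used on the
    segment joining two points, which lies in the interval J. *)
Lemma is_derive0_constant {R : realType} (J : set R) (f : R -> R) :
  is_interval J -> (forall t, J t -> is_derive t 1 f 0) ->
  forall s t, J s -> J t -> f s = f t.
Proof.
move=> iJ df s t Js Jt; wlog st : s t Js Jt / s <= t.
  by move=> h; case/orP: (le_total s t) => ?; [|apply/esym]; apply: h.
have dst z : z \in `[s, t] -> is_derive z 1 f 0.
  by rewrite in_itv /= => zst; exact/df/(iJ s t).
have cf : {within `[s, t], continuous f}.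
  by apply: derivable_within_continuous => z /dst[].
have dst' z : z \in `]s, t[ -> is_derive z 1 f ((fun=> 0) z).
  by move=> /subset_itv_oo_cc; exact: dst.
have [z _] := MVT_segment st dst' cf.
by rewrite mul0r => /eqP; rewrite subr_eq0 => /eqP.
Qed.

Section Bundle.
Context {R : realType} {n : nat} {Q : manifold R n}.
Implicit Types (a : chart Q) (u : tvec Q).

(** The last two fields of a tangent vector are proofs of propositions. *)
Lemma tvec_eq u w : base u = base w -> vel u = vel w -> u = w.
Proof.
case: u w => [q v vo vt] [q' v' vo' vt'] /= eq_q eq_v.
by case: q' / eq_q vo' vt'; case: v' / eq_v => vo' vt';
  congr TVec; exact: Prop_irrelevance.
Qed.

(** The components of u in another chart are the transition map's differential
    applied to those in a, or 0 outside that chart, which is also how [tpt]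
    extends (x, v) to all charts. *)
Lemma tcrdK a u : dom a (base u) -> tpt a (tcrd a u) = u.
Proof.
move=> au; have ptE : pt a (crd a (base u)) = base u by rewrite crdK.
apply: tvec_eq => //=; apply/funext => b; rewrite /tpt_vel /= ptE.
case: asboolP => [[_ bu]|nb]; first by rewrite -(vel_trans au bu).
by rewrite vel_out // => bu; apply: nb; split => //; exists (base u).
Qed.

Lemma rng_crd a q : dom a q -> rng a (crd a q).
Proof. by move=> aq; exists q. Qed.

Lemma near_dom {q : R -> Q} {t a} :
  {for t, continuous q} -> dom a (q t) -> \forall s \near t, dom a (q s).
Proof.
move=> qc aq; apply: qc; apply: open_nbhs_nbhs; split => //.
exact: dom_open.
Qed.

End Bundle.

(** * Motions *)

Section Motion.
Context {R : realType} {n : nat} {Q : manifold R n}.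
Variables (ip A : tvec Q -> tvec Q -> R).
Context {r : nat}.
Variables (Ceq : 'I_r -> tvec Q -> R) (W : set (tvec Q)).
Hypothesis hip : kinetic_metric ip.
Hypothesis Csmooth :
  forall (a : chart Q) b, smooth_on (loc_set a W) (loc_fun a (Ceq b)).
Implicit Types (a : chart Q) (t : R).

(** Newton's law, f being the covariant components of the reaction. *)
Lemma newton_covariantP a p (acc f : 'rV[R]_n) : rng a p.1 ->
  acc *m gmetric ip a p.1 + geodesic_row ip a p = force_row A a p + f <->
  acc = (force_row A a p - geodesic_row ip a p + f) *m inv_gmetric ip a p.1.
Proof.
move=> ax; have gU := gmetric_unitmx ip a hip _ ax; split=> [e|->].
  by rewrite addrAC -e addrK mulmxK.
by rewrite mulmxKV // addrAC subrK.
Qed.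

Lemma Gup_unitmx a p : rng a p.1 -> \rank (Cmx Ceq a p) = r ->
  Cmx Ceq a p *m inv_gmetric ip a p.1 *m (Cmx Ceq a p)^T \in unitmx.
Proof.
move=> ax rk; apply: gram_unitmx; first exact: gmetric_tr.
  exact: gmetric_posdef.
by rewrite /row_free rk.
Qed.

(** Chain rule: near t the equation is its coordinate expression composed with
    the coordinates of the curve, since the curve stays in the chart. *)
Lemma is_derive_equation (c : R -> tvec Q) t a (acc : 'rV[R]_n) b :
  W (c t) -> dom a (base (c t)) ->
  {for t, continuous (fun s => base (c s))} ->
  is_derive t 1 (fun s => tcrd a (c s)) ((tcrd a (c t)).2, acc) ->
  is_derive t 1 (fun s => Ceq b (c s))
    ((drift_row Ceq a (tcrd a (c t))
      + acc *m (Cmx Ceq a (tcrd a (c t)))^T) 0 b).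
Proof.
move=> Wt at_ cc dc; have [dct dcE] := is_derive_diff _ _ _ dc.
have df : differentiable (loc_fun a (Ceq b)) (tcrd a (c t)).
  have [+ _] := Csmooth a b 1%N; apply.
  by split; [exact: rng_crd | rewrite tcrdK].
have cE : \forall s \near t, loc_fun a (Ceq b) (tcrd a (c s)) = Ceq b (c s).
  apply: filterS (near_dom cc at_) => s as_.
  by rewrite /loc_fun tcrdK.
have := near_eq_is_derive cE (is_derive_comp_diff _ _ t (1 : R) dct df).
rewrite dcE diff_phase //= => h; apply: is_derive_eq h _.
rewrite !mxE; congr (_ + _).
by apply: eq_bigr => i _; rewrite !mxE.
Qed.

Lemma is_derive_lift (J : set R) (q : R -> Q) (c : R -> tvec Q) t a :
  open J -> tangent_lift J q c -> J t -> dom a (q t) ->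
  derivable (fun s => vel (c s) a) t 1 ->
  is_derive t 1 (fun s => tcrd a (c s))
    ((tcrd a (c t)).2, 'D_1 (fun s => vel (c s) a) t).
Proof.
move=> oJ lift Jt aq dvel; have [qc qE /(_ a aq) dq] := lift t Jt.
apply: is_derive_pair; last exact: derivableP.
apply: near_eq_is_derive dq.
have : nbhs t J by apply: open_nbhs_nbhs.
by apply: filterS => s /lift[_ -> _].
Qed.

Lemma lift_continuous (J : set R) (q : R -> Q) (c : R -> tvec Q) t :
  open J -> tangent_lift J q c -> J t ->
  {for t, continuous (fun s => base (c s))}.
Proof.
move=> oJ lift Jt; have [qc qE _] := lift t Jt.
have nE : \forall s \near t, q s = base (c s).
  have : nbhs t J by apply: open_nbhs_nbhs.
  by apply: filterS => s /lift[_ -> _].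
rewrite /prop_for /continuous_at /= qE.
exact: cvg_trans (near_eq_cvg nE) qc.
Qed.

(** The equations vanish along the motion, so the rate given by
    [is_derive_equation] is zero; this is the condition of [multiplierP], which
    determines the unknown multipliers of the ideal reaction. *)
Lemma actual_motion_reaction (C : set (tvec Q)) (J : set R) (q : R -> Q)
    (c : R -> tvec Q) (RF : R -> chart Q -> 'rV[R]_n) t a :
  (forall u, C u <-> W u /\ forall b, Ceq b u = 0) ->
  (forall a p, loc_set a C p -> \rank (Cmx Ceq a p) = r) ->
  open J -> actual_motion ip A Ceq C J q c RF -> J t -> dom a (q t) ->
  let p := tcrd a (c t) in
  RF t a = multiplier_row ip A Ceq a p *m Cmx Ceq a p /\
  is_derive t 1 (fun s => tcrd a (c s)) (D_field ip A Ceq a p).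
Proof.
move=> CE Crank oJ [lift lag ideal inC] Jt aq p.
have [qc qE _] := lift t Jt.
have ac : dom a (base (c t)) by rewrite qE.
have ax : rng a p.1 by exact: rng_crd.
have [Wt C0] := (CE _).1 (inC t Jt).
have [dvel lagt] := lag t a Jt ac.
have dc := is_derive_lift J q c t a oJ lift Jt aq dvel.
set acc := 'D_1 _ t in dc.
have [lam lamE] := ideal t a Jt ac.
pose l : 'rV[R]_r := \row_b lam b.
have RFE : RF t a = l *m Cmx Ceq a p.
  by apply/rowP => i; rewrite lamE mxE; apply: eq_bigr => b _; rewrite !mxE.
have accE : acc = (force_row A a p - geodesic_row ip a p + l *m Cmx Ceq a p)
    *m inv_gmetric ip a p.1.
  apply/newton_covariantP => //; apply/rowP => i.
  rewrite -(euler_lagrange_kinetic ip a hip _ _ _ _ ax dc) lagt RFE.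
  by rewrite [RHS]mxE [force_row _ _ _ _ _]mxE.
have bc := lift_continuous J q c t oJ lift Jt.
have GU : Cmx Ceq a p *m inv_gmetric ip a p.1 *m (Cmx Ceq a p)^T \in unitmx.
  apply: Gup_unitmx => //; apply: Crank; split=> //.
  by rewrite tcrdK //; exact: inC.
have lE : l = multiplier_row ip A Ceq a p.
  rewrite /multiplier_row /Glow GupE; apply/multiplierP => //.
  rewrite -accE; apply/rowP => b; rewrite [RHS]mxE.
  have [_ <-] := is_derive_equation c t a acc b Wt ac bc dc.
  rewrite (near_eq_derive (g := fun=> 0)) ?derive_cst //.
  have : nbhs t J by apply: open_nbhs_nbhs.
  by apply: filterS => s Js; have [_ ->] := (CE _).1 (inC s Js).
split; first by rewrite RFE lE.
by rewrite D_fieldE ?gmetric_tr // -lE -accE.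
Qed.

(** The multipliers in D are those that make the rate of change of every equation
    zero, on the whole domain of D and not only on the constraint: the equations
    are first integrals of D. *)
Lemma is_derive_equation_D (J : set R) (c : R -> tvec Q) t b :
  integral_curve_D ip A Ceq W J c -> J t ->
  is_derive t 1 (fun s => Ceq b (c s)) 0.
Proof.
move=> int Jt; have [[Wt rk] bc dc] := int t Jt.
have [a ac] := dom_cover (base (c t)).
have {}rk := rk a ac; have {dc} := dc a ac.
have ax : rng a (tcrd a (c t)).1 by exact: rng_crd.
rewrite D_fieldE ?gmetric_tr // => dc.
have := is_derive_equation c t a _ b Wt ac bc dc.
rewrite (multiplierP _ _ _ _ _ (Gup_unitmx a _ ax rk)).2 ?mxE //.
by rewrite /multiplier_row /Glow GupE.
Qed.

(** A first integral vanishing at the initial instant vanishes on the whole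
    interval; being in W is part of being in the domain of D. *)
Lemma integral_curve_constraint (C : set (tvec Q)) (J : set R) t0
    (c : R -> tvec Q) :
  (forall u, C u <-> W u /\ forall b, Ceq b u = 0) ->
  is_interval J -> J t0 -> integral_curve_D ip A Ceq W J c -> C (c t0) ->
  forall t, J t -> C (c t).
Proof.
move=> CE iJ J0 int C0 t Jt; apply/CE; split; first by have [[]] := int t Jt.
move=> b; have [_ /(_ b) <-] := (CE _).1 C0.
have dJ s : J s -> is_derive s 1 (fun s => Ceq b (c s)) 0.
  exact: is_derive_equation_D.
exact: is_derive0_constant iJ dJ _ _ Jt J0.
Qed.

(** The reaction is the one with the multipliers that appear in D, hence ideal by
    construction. *)
Lemma integral_curve_motion (C : set (tvec Q)) (J : set R) (c : R -> tvec Q) :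
  integral_curve_D ip A Ceq W J c -> (forall t, J t -> C (c t)) ->
  actual_motion ip A Ceq C J (fun s => base (c s)) c
    (fun t a => multiplier_row ip A Ceq a (tcrd a (c t))
                *m Cmx Ceq a (tcrd a (c t))).
Proof.
move=> int inC.
have ax t a : dom a (base (c t)) -> rng a (tcrd a (c t)).1.
  by move=> ac; exact: rng_crd.
split=> // [t Jt|t a Jt ac|t a Jt ac].
- have [_ bc dc] := int t Jt; split=> // a ac; have {dc} := dc a ac.
  rewrite D_fieldE ?(gmetric_tr ip a hip _ (ax t a ac)) // => dc.
  exact: is_derive_fst dc.
- have [_ bc dc] := int t Jt; have {dc} := dc a ac.
  rewrite D_fieldE ?(gmetric_tr ip a hip _ (ax t a ac)) // => dc; split.
    by have [] := is_derive_snd _ _ _ dc.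
  move=> i; rewrite (euler_lagrange_kinetic ip a hip _ _ _ _ (ax t a ac) dc).
  have -> := (newton_covariantP a (tcrd a (c t)) _ _ (ax t a ac)).2 erefl.
  by rewrite mxE [force_row _ _ _ _ _]mxE.
exists (fun b => multiplier_row ip A Ceq a (tcrd a (c t)) 0 b) => i.
by rewrite mxE; apply: eq_bigr => b _; rewrite [Cmx _ _ _ _ _]mxE.
Qed.
End Motion.

Theorem theorem8p2 (R : realType) (n m r : nat) (Q : manifold R n)
    (ip A : tvec Q -> tvec Q -> R)
    (C W : set (tvec Q)) (Ceq : 'I_r -> tvec Q -> R)
    (hm : (m < n)%N) (hr : r = (n - m)%N)
    (hip : kinetic_metric ip) (hA : force_law A)
    (hC : regular_constraint m C) (hCeq : independent_equations Ceq W C) :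
  (* the actual motions are the integral curves of D based on C *)
  (forall (J : set R) (t0 : R) (c : R -> tvec Q),
     open J -> is_interval J -> J t0 ->
     (integral_curve_D ip A Ceq W J c /\ C (c t0)) <->
     (exists (q : R -> Q) (RF : R -> chart Q -> 'rV[R]_n),
        actual_motion ip A Ceq C J q c RF)) /\
  (* the vector R gives the reactive force along every actual motion *)
  (forall (J : set R) (q : R -> Q) (c : R -> tvec Q)
      (RF : R -> chart Q -> 'rV[R]_n),
     open J -> is_interval J ->
     actual_motion ip A Ceq C J q c RF ->
     forall (t : R) (a : chart Q), J t -> dom a (q t) ->
     forall i, \sum_j inv_gmetric ip a (crd a (q t)) i j * RF t a 0 j =
               reactive_up ip A Ceq a (tcrd a (c t)) i) /\
  (* explicit expressions of D and R *)
  (forall (u : tvec Q) (a : chart Q), D_domain Ceq W u -> dom a (base u) ->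
     let p := tcrd a u in
     D_field ip A Ceq a p =
       (p.2, \row_i (\sum_j (inv_gmetric ip a p.1 i j - pi_tensor ip Ceq a p i j) *
                              (active_force A a j p - christoffel_vv ip a p j)
                     - drift ip Ceq a p i)) /\
     forall i, reactive_up ip A Ceq a p i =
       \sum_j pi_tensor ip Ceq a p i j *
                 (christoffel_vv ip a p j - active_force A a j p)
       - drift ip Ceq a p i).
Proof.
have [_ Csm CE Crank] := hCeq; split; [|split].
- move=> J t0 c oJ iJ J0; split=> [[int C0]|[q [RF mot]]].
    exists (fun s => base (c s)), (fun t a =>
      multiplier_row ip A Ceq a (tcrd a (c t)) *m Cmx Ceq a (tcrd a (c t))).
    apply: (integral_curve_motion ip A Ceq W hip C J c int).
    exact: (integral_curve_constraint ip A Ceq W hip Csm C J t0 c CE iJ J0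
                int C0).
  have [lift _ _ inC] := mot; split; last exact: inC.
  move=> t Jt; have [_ qE _] := lift t Jt.
  have [Wt _] := (CE _).1 (inC t Jt).
  split; last 1 first.
  + move=> a ac; rewrite qE in ac.
    exact: (actual_motion_reaction ip A Ceq W hip Csm C J q c RF t a
              CE Crank oJ mot Jt ac).2.
  + split=> // a ac; apply: Crank; split; first exact: rng_crd.
    by rewrite tcrdK //; exact: inC.
  + exact: (lift_continuous J q c t oJ lift Jt).
- move=> J q c RF oJ _ mot t a Jt aq i.
  have [lift _ _ _] := mot; have [_ qE _] := lift t Jt.
  have ac : dom a (base (c t)) by rewrite qE.
  have gsym := gmetric_tr ip a hip _ (rng_crd a _ ac).
  have [-> _] := actual_motion_reaction ip A Ceq W hip Csm C J q c RF t a
                   CE Crank oJ mot Jt aq.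
  rewrite (reactive_upE ip A Ceq a (tcrd a (c t)) gsym) [RHS]mxE -qE.
  apply: eq_bigr => j _.
  by rewrite (inv_gmetric_sym ip a (tcrd a (c t)) gsym) mulrC.
- move=> u a _ au p; have gsym := gmetric_tr ip a hip _ (rng_crd a _ au).
  split; first exact: D_field_pi.
  by move=> i; exact: reactive_up_pi.
Qed.
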